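(* Let $F=g+h\circ c$ be the composite function described in the context, with $\mu=L\beta$, and assume $M:=\sup_{x,y\in\operatorname{dom} g}\|x-y\|<\infty$. Let $\rho\ge0$ be a weak convexity constant of $h\circ c$ on $\operatorname{dom} g$ and let $r\ge0$ be a convexity constant of the pair $(h,c)$ on $\operatorname{dom} g$. Fix a real $\tilde\mu>\mu$, points $x_0,v_0\in\operatorname{dom} g$, and sequences $\varepsilon_i,\delta_i\ge0$ ($i\ge1$). For $k\ge1$ set $a_k=\frac{2}{k+1}$, $y_k=a_kv_{k-1}+(1-a_k)x_{k-1}$, let $x_k$ be any $\varepsilon_k$-approximate minimizer of $F_{1/\tilde\mu}(\cdot;y_k)$, and let $v_k$ be any $\delta_k$-approximate minimizer of $F_{\frac{1}{\tilde\mu a_k},a_k}(\cdot;y_k,v_{k-1})$. Let $x^*$ be any point satisfying $F(x^* )\le F(x_k)$ for all iterates $x_k$. Then for every $N\ge1$, $$\min_{i=1,\ldots,N}\|\mathcal{G}_{1/\tilde\mu}(y_i)\|^2\le\frac{96\tilde\mu^2}{\tilde\mu-\mu}\left(\frac{\tilde\mu\|x^*-v_0\|^2}{2N(N+1)(2N+1)}+\frac{M^2\big(r+\frac\rho2(N+3)\big)}{2(N+1)(2N+1)}+\frac{\sum_{i=1}^N\frac{\delta_ia_i+3\varepsilon_i}{a_i^2}+A_N\sqrt{2\tilde\mu}\sum_{i=1}^N\sqrt{\frac{\delta_i}{a_i}}}{N(N+1)(2N+1)}\right)$$ with $$A_N:=\sqrt{\tfrac{2}{\tilde\mu}}\sum_{i=1}^N\sqrt{\tfrac{\delta_i}{a_i}}+\left(\|x^*-v_0\|^2+\tfrac{M^2N\left(r+\frac\rho2(N+3)\right)}{\tilde\mu}+\tfrac2{\tilde\mu}\sum_{i=1}^N\tfrac{\delta_ia_i+2\varepsilon_i}{a_i^2}+\tfrac2{\tilde\mu}\Big(\sum_{i=1}^N\sqrt{\tfrac{\delta_i}{a_i}}\Big)^2\right)^{1/2}.$$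 Moreover, in the case $r=0$, the inequality above holds with the second summand in the parentheses on the right-hand side replaced by zero (even if $M=\infty$, the term of $A_N$ containing $M$ being then also read as zero), and $$F(x_N)-F(x^* )\le\frac{2\tilde\mu\|x^*-v_0\|^2+4\sum_{i=1}^N\frac{\delta_ia_i+2\varepsilon_i}{a_i^2}+4A_N\sqrt{2\tilde\mu}\sum_{i=1}^N\sqrt{\frac{\delta_i}{a_i}}}{(N+1)^2}.$$
   Context: Setting: $g\colon\mathbf{R}^d\to\mathbf{R}\cup\{+\infty\}$ is proper, closed and convex; $h\colon\mathbf{R}^m\to\mathbf{R}$ is convex and $L$-Lipschitz continuous; $c\colon\mathbf{R}^d\to\mathbf{R}^m$ is $C^1$-smooth with $\|\nabla c(x)-\nabla c(y)\|_{\rm op}\le\beta\|x-y\|$ for all $x,y$. Set $\mu:=L\beta$ and $F(x):=g(x)+h(c(x))$. Notation: for $t,\alpha>0$, $F_t(z;y):=g(z)+h\big(c(y)+\nabla c(y)(z-y)\big)+\frac{1}{2t}\|z-y\|^2$, $S_t(y):=\operatorname{argmin}_zF_t(z;y)$, $\mathcal{G}_t(x):=t^{-1}(x-S_t(x))$; and $F_{t,\alpha}(z;y,v):=g(z)+\frac1\alpha h\big(c(y)+\alpha\nabla c(y)(z-v)\big)+\frac{1}{2t}\|z-v\|^2$. A point $x$ is an $\varepsilon$-approximate minimizer of $f$ if $f(x)\le\inf f+\varepsilon$. Weak convexity: $\Phi$ is $\rho$-weakly convex on a set $U$ ($\rho$ is a weak convexity constant of $\Phi$ on $U$) if $\Phi(ax+(1-a)y)\le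 a\Phi(x)+(1-a)\Phi(y)+\rho a(1-a)\|x-y\|^2$ for all $x,y\in U$, $a\in[0,1]$. Convexity of the pair: $r\ge0$ is a convexity constant of $(h,c)$ on $U$ if $h\big(c(y)+\nabla c(y)(z-y)\big)\le h(c(z))+\frac r2\|z-y\|^2$ for all $z,y\in U$. Such constants exist with $0\le\rho\le r\le\mu$, and without loss of generality the paper takes $0\le\rho\le r\le\mu$. *)

(* Defs.v *)
From HB Require Import structures.
From mathcomp Require Import all_boot all_order all_algebra.
From mathcomp Require Import all_classical all_reals all_analysis.

Set Implicit Arguments.
Unset Strict Implicit.
Unset Printing Implicit Defensive.
Import Order.TTheory GRing.Theory Num.Theory.
Import numFieldNormedType.Exports.

Local Open Scope classical_set_scope.
Local Open Scope ring_scope.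

Section euclidean.
Context {R : realType}.

(* The norm `|x| carried by 'rV[R]_n is the sup norm, hence a separate
   Euclidean norm; both induce the same topology and the same differential. *)
Definition l2norm n (x : 'rV[R]_n) : R := Num.sqrt (\sum_i x ord0 i ^+ 2).

(* Linear maps act on row vectors by u |-> u *m A, as for [jacobian]. *)
Definition opnorm d m (A : 'M[R]_(d, m)) : R :=
  sup [set l2norm (u *m A) | u in [set u : 'rV[R]_d | l2norm u <= 1]].

Definition lipschitz2 m (L : R) (h : 'rV[R]_m -> R) : Prop :=
  forall u w, `|h u - h w| <= L * l2norm (u - w).

Definition C1_smooth d m (c : 'rV[R]_d -> 'rV[R]_m) : Prop :=
  (forall x, differentiable c x) /\ continuous (jacobian c).

Definition jacobian_lipschitz d m (beta : R) (c : 'rV[R]_d -> 'rV[R]_m) : Prop :=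
  forall x y, opnorm (jacobian c x - jacobian c y) <= beta * l2norm (x - y).

End euclidean.

Section extended_valued.
Context {R : realType} {d : nat}.
Implicit Types (g f : 'rV[R]_d -> \bar R).

Definition edom g : set 'rV[R]_d := [set x | (g x < +oo)%E].

Definition proper_fun g : Prop := (forall x, g x != -oo%E) /\ edom g !=set0.

Definition closed_fun g : Prop :=
  closed [set p : 'rV[R]_d * R | (g p.1 <= p.2%:E)%E].

(* Used only for functions that avoid -oo; recall that 0 * +oo = 0 in \bar R. *)
Definition convex_efun g : Prop :=
  forall (x y : 'rV[R]_d) (a : R), 0 <= a <= 1 ->
    (g (a *: x + (1 - a) *: y)%R <= a%:E * g x + (1 - a)%R%:E * g y)%E.

Definition diameter (U : set 'rV[R]_d) : \bar R :=
  ereal_sup [set (l2norm (p.1 - p.2))%:E | p in U `*` U].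

Definition approx_minimizer f (eps : R) (x : 'rV[R]_d) : Prop :=
  (f x <= ereal_inf (range f) + eps%:E)%E.

Definition argmin f : set 'rV[R]_d := [set z | forall w, (f z <= f w)%E].

(* No factor 1/2 in front of rho. *)
Definition weakly_convex_on (U : set 'rV[R]_d) (rho : R) (Phi : 'rV[R]_d -> R) : Prop :=
  forall x y (a : R), U x -> U y -> 0 <= a <= 1 ->
    Phi (a *: x + (1 - a) *: y) <=
      a * Phi x + (1 - a) * Phi y + rho * a * (1 - a) * l2norm (x - y) ^+ 2.

End extended_valued.

Section composite.
Context {R : realType} {d m : nat}.
Variables (g : 'rV[R]_d -> \bar R) (h : 'rV[R]_m -> R) (c : 'rV[R]_d -> 'rV[R]_m).

Definition convexity_constant (U : set 'rV[R]_d) (r : R) : Prop :=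
  forall z y, U z -> U y ->
    h (c y + (z - y) *m jacobian c y) <= h (c z) + r / 2 * l2norm (z - y) ^+ 2.

Definition composite (x : 'rV[R]_d) : \bar R := (g x + (h (c x))%:E)%E.

Definition prox_model (t : R) (y z : 'rV[R]_d) : \bar R :=
  (g z + (h (c y + (z - y) *m jacobian c y)
          + (2 * t)^-1 * l2norm (z - y) ^+ 2)%R%:E)%E.

Definition acc_model (t alpha : R) (y v z : 'rV[R]_d) : \bar R :=
  (g z + (alpha^-1 * h (c y + alpha *: ((z - v) *m jacobian c y))
          + (2 * t)^-1 * l2norm (z - v) ^+ 2)%R%:E)%E.

(* For t > 0 the model is closed and strongly convex, so the argmin is a
   singleton; the default value 0 is then never used. *)
Definition prox_step (t : R) (y : 'rV[R]_d) : 'rV[R]_d :=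
  xget 0 (argmin (prox_model t y)).

Definition prox_gradient (t : R) (x : 'rV[R]_d) : 'rV[R]_d :=
  t^-1 *: (x - prox_step t x).

End composite.

Section accelerated_method.
Context {R : realType}.

Definition acc_weight (k : nat) : R := 2 / k.+1%:R.

Definition acc_point d (x v : nat -> 'rV[R]_d) (k : nat) : 'rV[R]_d :=
  acc_weight k *: v k.-1 + (1 - acc_weight k) *: x k.-1.

(* sequences indexed from 1; y_k is [acc_point x v k] *)
Definition inexact_acc_prox_linear d m
    (g : 'rV[R]_d -> \bar R) (h : 'rV[R]_m -> R) (c : 'rV[R]_d -> 'rV[R]_m)
    (mut : R) (eps delta : nat -> R) (x v : nat -> 'rV[R]_d) : Prop :=
  [/\ edom g (x 0%N), edom g (v 0%N) &
  forall k, (1 <= k)%N ->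
    approx_minimizer (prox_model g h c mut^-1 (acc_point x v k)) (eps k) (x k) /\
    approx_minimizer
      (acc_model g h c (mut * acc_weight k)^-1 (acc_weight k)
         (acc_point x v k) (v k.-1))
      (delta k) (v k)].

Local Notation a := acc_weight.

(* In the bounds below D stands for |x^* - v_0| and K for the quantity
   M^2 (r + rho / 2 (N + 3)), which is 0 when r = 0. *)

Definition sum_sqrt_delta (delta : nat -> R) (N : nat) : R :=
  \sum_(1 <= i < N.+1) Num.sqrt (delta i / a i).

Definition sum_err (q : R) (eps delta : nat -> R) (N : nat) : R :=
  \sum_(1 <= i < N.+1) (delta i * a i + q * eps i) / a i ^+ 2.

Definition err_A (mut D K : R) (eps delta : nat -> R) (N : nat) : R :=
  Num.sqrt (2 / mut) * sum_sqrt_delta delta N +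
  Num.sqrt (D ^+ 2 + N%:R * K / mut + 2 / mut * sum_err 2 eps delta N +
            2 / mut * sum_sqrt_delta delta N ^+ 2).

Definition stationarity_bound (mu mut D K : R) (eps delta : nat -> R) (N : nat) : R :=
  96 * mut ^+ 2 / (mut - mu) *
  (mut * D ^+ 2 / (2 * N%:R * (N%:R + 1) * (2 * N%:R + 1)) +
   K / (2 * (N%:R + 1) * (2 * N%:R + 1)) +
   (sum_err 3 eps delta N +
    err_A mut D K eps delta N * Num.sqrt (2 * mut) * sum_sqrt_delta delta N) /
     (N%:R * (N%:R + 1) * (2 * N%:R + 1))).

Definition value_bound (mut D K : R) (eps delta : nat -> R) (N : nat) : R :=
  (2 * mut * D ^+ 2 + 4 * sum_err 2 eps delta N +
   4 * err_A mut D K eps delta N * Num.sqrt (2 * mut) * sum_sqrt_delta delta N) /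
  (N%:R + 1) ^+ 2.

End accelerated_method.

(* Main.v *)
Require Import Defs.
From mathcomp Require Import all_boot all_order all_algebra.
From mathcomp Require Import all_classical all_reals all_analysis.
From mathcomp Require Import ring lra.

Set Implicit Arguments.
Unset Strict Implicit.
Unset Printing Implicit Defensive.
Import Order.TTheory GRing.Theory Num.Theory.
Import numFieldNormedType.Exports.

Local Open Scope classical_set_scope.
Local Open Scope ring_scope.

(** Write F = g + h o c, mu = L beta, gap_k = F(x_k) - F(x^* ), u_k = |x^* - v_k|
    and a = a_k. The two bounds come from a single recursion, obtained by
    comparing the iterates with two points of the segments from x_{k-1}:
    w = a v_k + (1 - a) x_{k-1} and w^* = a x^* + (1 - a) x_{k-1}, for which
    w - y_k = a (v_k - v_{k-1}) and w^* - y_k = a (x^* - v_{k-1}).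

    - Linearizing c costs at most mu/2 |z - y|^2 (linearization_error), so F(x_k)
      is below the proximal model at x_k by (mut - mu)/2 |x_k - y_k|^2.
    - Approximate minimality of x_k compares the proximal model at x_k with its
      value at w; since w - y_k is proportional to v_k - v_{k-1}, the linear part
      of the latter is that of the second model at v_k.
    - The second model is mut a-strongly convex, so approximate minimality of v_k
      compares it with its value at x^* with a gain mut a/2 u_k^2, at the price of
      an error sqrt(2 mut a delta_k) u_k + delta_k (approx_min_gap).
    - The linear part at x^* is that of the proximal model at w^*, and the constants
      r and rho bound it by a convex combination of h(c x^* ) and h(c x_{k-1}).

    This gives accelerated_step. Dividing by a_k^2, the weights 1/a_k^2 = (k+1)^2/4
    make the gaps telescope because (1 - a_k)/a_k^2 = (k^2 - 1)/4 is at most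
    1/a_{k-1}^2, and the sum (cumulative_bound) controls at once gap_N/a_N^2,
    mut/2 u_N^2 and the sum of (mut - mu)/2 |x_i - y_i|^2/a_i^2. Its right-hand side
    still contains the u_i, linearly; as the left-hand side contains u_N^2, this
    quadratic inequality closes up and yields u_i <= A_N (distance_bound).

    The value bound is then immediate. For stationarity, G(y_i) is governed by
    |y_i - S(y_i)|, hence by |x_i - y_i| and by |x_i - S(y_i)|, the latter being
    O(sqrt(eps_i)) by strong convexity of the proximal model; the minimum over i is
    at most the average with weights 1/a_i^2, whose sum is at least
    N(N+1)(2N+1)/24. The proximal point S(y_i) exists because a minimizing sequence
    of a strongly convex function is Cauchy (argmin_strongly_convex).

    When r = 0, h o c is convex on dom g, so rho = 0 is also admissible and no
    diameter enters: the general argument then applies with M = 0. *)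

(** * The Euclidean norm *)

Section euclidean_norm.
Context {R : realType}.

Definition dotp n (u w : 'rV[R]_n) : R := \sum_i u ord0 i * w ord0 i.

Lemma l2norm_ge0 n (x : 'rV[R]_n) : 0 <= l2norm x.
Proof. exact: sqrtr_ge0. Qed.

Lemma l2norm_sqr n (x : 'rV[R]_n) : l2norm x ^+ 2 = \sum_i x ord0 i ^+ 2.
Proof. by rewrite sqr_sqrtr// sumr_ge0// => i _; exact: sqr_ge0. Qed.

Lemma dotpp n (x : 'rV[R]_n) : dotp x x = l2norm x ^+ 2.
Proof. by rewrite l2norm_sqr; apply: eq_bigr => i _; rewrite expr2. Qed.

Lemma l2norm_le n (x : 'rV[R]_n) (b : R) :
  0 <= b -> l2norm x ^+ 2 <= b ^+ 2 -> l2norm x <= b.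
Proof. by move=> b0; rewrite ler_pXn2r// nnegrE// l2norm_ge0. Qed.

Lemma l2normZ n (a : R) (x : 'rV[R]_n) : l2norm (a *: x) = `|a| * l2norm x.
Proof.
apply/eqP; rewrite -(@eqrXn2 _ 2)// ?mulr_ge0 ?l2norm_ge0//.
rewrite exprMn real_normK ?num_real// !l2norm_sqr mulr_sumr.
by apply/eqP/eq_bigr => i _; rewrite mxE exprMn.
Qed.

Lemma l2normB n (x y : 'rV[R]_n) : l2norm (x - y) = l2norm (y - x).
Proof. by rewrite -opprB -scaleN1r l2normZ normrN1 mul1r. Qed.

Lemma l2norm_eq0 n (x : 'rV[R]_n) : l2norm x = 0 -> x = 0.
Proof.
move=> x0; apply/rowP => i; rewrite mxE.
have /eqP := l2norm_sqr x; rewrite x0 expr0n/= eq_sym psumr_eq0; last first.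
  by move=> j _; exact: sqr_ge0.
by move=> /allP/(_ i (mem_index_enum _)); rewrite implyTb sqrf_eq0 => /eqP.
Qed.

Lemma l2norm_combB_sqr n (a b : R) (u w : 'rV[R]_n) :
  l2norm (a *: u - b *: w) ^+ 2 =
  a ^+ 2 * l2norm u ^+ 2 - 2 * a * b * dotp u w + b ^+ 2 * l2norm w ^+ 2.
Proof.
rewrite !l2norm_sqr !mulr_sumr -sumrB -big_split/=.
by apply: eq_bigr => i _; rewrite !mxE; ring.
Qed.

Lemma CauchySchwarz_dotp n (u w : 'rV[R]_n) :
  dotp u w <= l2norm u * l2norm w.
Proof.
have [w0|w0] := eqVneq (l2norm w) 0.
  rewrite w0 mulr0 (l2norm_eq0 w0) /dotp big1// => i _.
  by rewrite mxE mulr0.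
have wp : 0 < l2norm w ^+ 2 by rewrite exprn_gt0// lt0r w0 l2norm_ge0.
have : 0 <= l2norm (l2norm w ^+ 2 *: u - dotp u w *: w) ^+ 2 by exact: sqr_ge0.
rewrite l2norm_combB_sqr.
rewrite (_ : _ + _ = l2norm w ^+ 2 *
  ((l2norm u * l2norm w) ^+ 2 - dotp u w ^+ 2)); last by ring.
rewrite pmulr_rge0// subr_ge0 => /(ler_wsqrtr).
rewrite !sqrtr_sqr => h; apply: le_trans (ler_norm _) (le_trans h _).
by rewrite ger0_norm// mulr_ge0// l2norm_ge0.
Qed.

(** The squared norm is strongly convex with equality; this is the source of the
    quadratic gains in the proximal models. *)
Lemma l2norm_conv_sqr n (a : R) (x y w : 'rV[R]_n) :
  l2norm (a *: x + (1 - a) *: y - w) ^+ 2 =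
  a * l2norm (x - w) ^+ 2 + (1 - a) * l2norm (y - w) ^+ 2
  - a * (1 - a) * l2norm (x - y) ^+ 2.
Proof.
rewrite !l2norm_sqr !mulr_sumr -big_split -sumrB/=.
by apply: eq_bigr => i _; rewrite !mxE; ring.
Qed.

Lemma l2norm_sqrB_le n (x y w : 'rV[R]_n) :
  l2norm (x - y) ^+ 2 <= 2 * l2norm (x - w) ^+ 2 + 2 * l2norm (w - y) ^+ 2.
Proof.
rewrite !l2norm_sqr !mulr_sumr -big_split/=.
apply: ler_sum => i _; rewrite !mxE.
by rewrite -subr_ge0 (_ : _ - _ = (x ord0 i - w ord0 i - (w ord0 i - y ord0 i)) ^+ 2)
  ?sqr_ge0//; ring.
Qed.

Lemma l2norm_le_sum n (x : 'rV[R]_n) : l2norm x <= n%:R * `|x|.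
Proof.
apply: l2norm_le; first by rewrite mulr_ge0.
rewrite l2norm_sqr.
have xi i : x ord0 i ^+ 2 <= `|x| ^+ 2.
  rewrite -real_normK ?num_real// ler_pXn2r ?nnegrE//.
  by rewrite [leRHS]/Num.norm/= mx_normrE; apply/bigmax_geP; right => /=; exists (ord0, i).
apply: (@le_trans _ _ (\sum_(i < n) `|x| ^+ 2)); first exact: ler_sum.
rewrite sumr_const card_ord -[leLHS]mulr_natl exprMn ler_wpM2r ?sqr_ge0//.
by rewrite -natrX ler_nat; case: n {x xi} => // n; rewrite expnS leq_pmulr ?expn_gt0.
Qed.

Lemma norm_le_l2norm n (x : 'rV[R]_n) : `|x| <= l2norm x.
Proof.
rewrite [leLHS]/Num.norm/= mx_normrE; apply: bigmax_le; first exact: l2norm_ge0.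
move=> [i j] _ /=; rewrite (ord1 i).
rewrite -(@ler_pXn2r _ 2)// ?nnegrE ?l2norm_ge0// l2norm_sqr real_normK ?num_real//.
by rewrite (bigD1 j)//= lerDl sumr_ge0// => k _; exact: sqr_ge0.
Qed.

Lemma ler_l2normD n (x y : 'rV[R]_n) : l2norm (x + y) <= l2norm x + l2norm y.
Proof.
apply: l2norm_le; first by rewrite addr_ge0 ?l2norm_ge0.
have := l2norm_combB_sqr 1 (-1) x y; rewrite scale1r scaleN1r opprK => ->.
by have := CauchySchwarz_dotp x y; lra.
Qed.

Lemma lipschitz2_l2dist n (y : 'rV[R]_n) : lipschitz2 1 (fun z => l2norm (z - y)).
Proof.
have dist_le (z w : 'rV[R]_n) : l2norm (z - y) <= l2norm (z - w) + l2norm (w - y).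
  by rewrite -[z - y](subrKA w); exact: ler_l2normD.
move=> z w; have := dist_le z w; have := dist_le w z.
by rewrite (l2normB w z) mul1r ler_norml; move=> h1 h2; apply/andP; split; lra.
Qed.

(** A crude bound with the Frobenius norm; it shows that the set whose supremum
    is the operator norm is bounded, which l2norm_mul_opnorm relies on. *)
Lemma l2norm_mul_le n p (u : 'rV[R]_n) (A : 'M[R]_(n, p)) :
  l2norm (u *m A) <= l2norm u * Num.sqrt (\sum_j l2norm (col j A)^T ^+ 2).
Proof.
apply: l2norm_le; first by rewrite mulr_ge0 ?l2norm_ge0 ?sqrtr_ge0.
rewrite exprMn [X in _ <= _ * X]sqr_sqrtr; last by apply: sumr_ge0 => j _; exact: sqr_ge0.
rewrite l2norm_sqr mulr_sumr; apply: ler_sum => j _.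
have -> : (u *m A) ord0 j = dotp u (col j A)^T.
  by rewrite mxE; apply: eq_bigr => i _; rewrite !mxE.
rewrite -exprMn -[leLHS]real_normK ?num_real// ler_pXn2r ?nnegrE ?mulr_ge0 ?l2norm_ge0//.
rewrite ler_norml CauchySchwarz_dotp andbT lerNl.
rewrite (_ : - dotp _ _ = dotp (- u) (col j A)^T); last first.
  by rewrite /dotp -sumrN; apply: eq_bigr => i _; rewrite -mulNr; congr (_ * _); rewrite mxE.
by apply: le_trans (CauchySchwarz_dotp _ _) _; rewrite -scaleN1r l2normZ normrN1 mul1r.
Qed.

Lemma l2norm_mul_opnorm n p (u : 'rV[R]_n) (A : 'M[R]_(n, p)) :
  l2norm (u *m A) <= opnorm A * l2norm u.
Proof.
have [u0|u0] := eqVneq (l2norm u) 0.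
  by rewrite u0 mulr0; apply: (le_trans (l2norm_mul_le _ _)); rewrite u0 mul0r.
have up : 0 < l2norm u by rewrite lt0r u0 l2norm_ge0.
rewrite -ler_pdivrMr//.
apply: ub_le_sup.
  exists (Num.sqrt (\sum_j l2norm (col j A)^T ^+ 2)) => _ [w /= w1 <-].
  apply: (le_trans (l2norm_mul_le _ _)).
  by rewrite -[leRHS]mul1r ler_wpM2r// sqrtr_ge0.
exists ((l2norm u)^-1 *: u) => /=.
  by rewrite l2normZ ger0_norm ?invr_ge0 ?l2norm_ge0// mulVf.
by rewrite -scalemxAl l2normZ ger0_norm ?invr_ge0 ?l2norm_ge0// mulrC.
Qed.

End euclidean_norm.

(** * The linearization error of a map with Lipschitz Jacobian *)

(** Subtracting the polynomial k t + Q t^2 leaves a nonincreasing function. *)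
Lemma increment_le_of_derive_le (R : realType) (f df : R -> R) (k Q : R) :
  (forall t, is_derive t (1 : R) f (df t)) ->
  (forall t, 0 <= t -> df t <= k + 2 * Q * t) ->
  f 1 - f 0 <= k + Q.
Proof.
move=> Df dfle; pose p : {poly R} := k *: 'X + Q *: 'X^2.
have Dp t : is_derive t (1 : R) (f - horner p) (df t - p^`().[t]).
  exact: is_deriveB (Df t) (is_derive_poly p t).
have h : (f - horner p) 1 <= (f - horner p) 0.
  apply: (@ler0_derive1_le_cc _ (f - horner p) 0 1); rewrite ?in_itv/= ?lexx ?ler01//.
  - move=> t; rewrite in_itv/= => /andP[t0 _].
    rewrite derive1E (@derive_val _ _ _ _ _ _ _ (Dp t)) subr_le0 /p derivD !derivZ derivX derivXn !hornerE.
    by apply: le_trans (dfle t (ltW t0)) _; rewrite lerD2l; lra.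
  - apply: derivable_within_continuous => t _; exact: ex_derive.
have p1 : p.[1] = k + Q by rewrite /p !hornerE /= !mulr1.
have p0 : p.[0] = 0 by rewrite /p !hornerE /= !mulr0.
by move: h; rewrite !fctE p1 p0; lra.
Qed.

Lemma dotpBr (R : realType) n (u w1 w2 : 'rV[R]_n) :
  dotp u (w1 - w2) = dotp u w1 - dotp u w2.
Proof. by rewrite -sumrB/=; apply: eq_bigr => i _; rewrite !mxE mulrBr. Qed.

Lemma dotp_mulmx_le (R : realType) n p (u : 'rV[R]_p) (w : 'rV[R]_n) (A B : 'M[R]_(n, p)) :
  dotp u (w *m A) <= dotp u (w *m B) + opnorm (A - B) * l2norm w * l2norm u.
Proof.
rewrite -lerBlDl -dotpBr -mulmxBr mulrC.
apply: le_trans (CauchySchwarz_dotp _ _) _.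
by rewrite ler_wpM2l ?l2norm_ge0 ?l2norm_mul_opnorm.
Qed.

Section descent.
Context {R : realType} {d m : nat}.
Variables (c : 'rV[R]_d -> 'rV[R]_m).

(** The difference quotients of s |-> c (y + s w) at t are the directional ones
    of c at y + t w. *)
Lemma is_derive_dotp_line (e : 'rV[R]_m) (y w : 'rV[R]_d) (t : R) :
  (forall x, differentiable c x) ->
  is_derive t 1 (fun s : R => dotp e (c (y + s *: w)))
    (dotp e (w *m jacobian c (y + t *: w))).
Proof.
move=> dc; set f := fun s : R => c (y + s *: w).
have line : (fun h : R => h^-1 *: ((f \o shift t) (h *: 1) - f t)) =
    (fun h : R => h^-1 *: ((c \o shift (y + t *: w)) (h *: w) - c (y + t *: w))).
  apply/funext => h /=; rewrite /f; congr (_ *: (c _ - _)).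
  have -> : h *: (1 : R) = h by exact: mulr1.
  by rewrite scalerDl addrCA.
have Df : 'D_1 f t = w *m jacobian c (y + t *: w).
  by rewrite -deriveEjacobian// /derive line.
have df : derivable f t 1.
  by rewrite /derivable line; exact: diff_derivable.
have /derivable_mxP Mf := df.
rewrite (_ : (fun s => _) =
    \sum_(j < m) (e ord0 j *: (fun s : R => f s ord0 j))); last first.
  by apply/funext => s; rewrite fct_sumE.
rewrite -Df derive_mx//.
apply: (is_derive_eq (f' :=
    \sum_(j < m) e ord0 j *: 'D_1 (fun s : R => f s ord0 j) t)); last first.
  by apply: eq_bigr => j _; rewrite mxE.
apply: is_derive_sum => j; apply: is_deriveZ; apply: derivableP; exact: Mf.
Qed.


(** Testing against a fixed vector u reduces the vector-valued Taylor estimate to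
    the scalar function s |-> <u, c (y + s w)>, whose derivative at s exceeds its
    derivative at 0 by at most beta s |w|^2 |u|. *)
Lemma dotp_linearization_error (beta : R) (u : 'rV[R]_m) (y w : 'rV[R]_d) :
  C1_smooth c -> jacobian_lipschitz beta c ->
  dotp u (c (y + w) - c y) <=
    dotp u (w *m jacobian c y) + beta / 2 * l2norm w ^+ 2 * l2norm u.
Proof.
move=> [dc _] cl.
have Df t := is_derive_dotp_line u y w t dc.
have /= H := increment_le_of_derive_le Df.
rewrite dotpBr; move: H; rewrite scale0r addr0 scale1r; apply => t t0.
apply: le_trans (dotp_mulmx_le _ _ _ (jacobian c y)) _; rewrite lerD2l.
have -> : 2 * (beta / 2 * l2norm w ^+ 2 * l2norm u) * t =
    beta * (t * l2norm w) * l2norm w * l2norm u by field.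
rewrite !ler_wpM2r ?l2norm_ge0//.
have := cl (y + t *: w) y.
by rewrite [y + _]addrC addrK l2normZ ger0_norm.
Qed.

(** Testing the error against itself, then dividing by its norm. *)
Lemma linearization_error (beta : R) (y z : 'rV[R]_d) :
  C1_smooth c -> 0 <= beta -> jacobian_lipschitz beta c ->
  l2norm (c z - (c y + (z - y) *m jacobian c y)) <= beta / 2 * l2norm (z - y) ^+ 2.
Proof.
move=> cC1 b0 cl; set e := (X in l2norm X <= _).
have := dotp_linearization_error e y (z - y) cC1 cl.
rewrite [y + _]addrC subrK -lerBlDl -dotpBr -addrA -opprD -/e dotpp.
have [-> _|e0] := eqVneq (l2norm e) 0; first by rewrite mulr_ge0 ?sqr_ge0// divr_ge0.
by rewrite expr2 ler_pM2r// lt0r e0 l2norm_ge0.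
Qed.

End descent.

(** * Strong and weak convexity *)

(** Strong convexity with modulus kappa is weak convexity with the negative
    constant - (kappa / 2), so both obey the same calculus. *)
Section strong_convexity.
Context {R : realType} {d : nat}.
Implicit Types (U : set 'rV[R]_d) (f : 'rV[R]_d -> R).

Definition segment_closed U := forall x y (a : R), U x -> U y ->
  0 <= a <= 1 -> U (a *: x + (1 - a) *: y).

(** Comparing v with the point at parameter s of the segment from v to z gives
    s X <= s^2 K + delta, with X = f v - f z + K and K = kappa / 2 |z - v|^2. The
    best s is sqrt(2 kappa delta) / (kappa |z - v|); it exceeds 1 when z is close
    to v, and then s = 1 is good enough. For delta = 0 one lets s tend to 0. *)
Lemma approx_min_gap U f (kappa delta : R) v z :
  segment_closed U -> 0 < kappa -> weakly_convex_on U (- (kappa / 2)) f ->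
  0 <= delta -> U v -> U z -> (forall w, U w -> f v <= f w + delta) ->
  f v <= f z - kappa / 2 * l2norm (z - v) ^+ 2
         + Num.sqrt (2 * kappa * delta) * l2norm (z - v) + delta.
Proof.
move=> Ucvx k0 fcvx d0 Uv Uz fv.
set D := l2norm (z - v); have D0 : 0 <= D by exact: l2norm_ge0.
set q := Num.sqrt _; have q0 : 0 <= q by exact: sqrtr_ge0.
have q2 : q ^+ 2 = 2 * kappa * delta.
  by rewrite sqr_sqrtr// mulr_ge0// mulr_ge0// ltW.
have seg s : 0 < s <= 1 ->
    s * (f v - f z + kappa / 2 * D ^+ 2) <= s ^+ 2 * (kappa / 2 * D ^+ 2) + delta.
  move=> /andP[s0 s1].
  have s01 : 0 <= s <= 1 by rewrite ltW.
  have := fv _ (Ucvx _ _ _ Uz Uv s01).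
  have := fcvx _ _ _ Uz Uv s01; rewrite -/D.
  by move: (f (s *: z + _)) (f z) (f v) => F Fz Fv; lra.
have [qD|qD] := leP (kappa * D) q.
  have := fv z Uz.
  have : 0 <= D * (q - kappa / 2 * D).
    rewrite mulr_ge0// subr_ge0; apply: le_trans qD.
    by rewrite mulrAC ler_pdivrMr// ler_peMr ?ler1n// mulr_ge0// ltW.
  move: (f v) (f z) => Fv Fz; rewrite mulrBr; nra.
have Dp : 0 < D by rewrite lt0r D0 andbT; apply: contraTneq qD => ->; rewrite mulr0 -leNgt.
move: seg; set K := kappa / 2 * D ^+ 2; set X := _ - _ + K => seg.
have Kp : 0 < K by rewrite mulr_gt0 ?exprn_gt0// divr_gt0.
suff : X <= q * D + delta by rewrite /X; lra.
have [q_eq0|q_neq0] := eqVneq q 0.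
  have d_eq0 : delta = 0.
    by move: q2; rewrite q_eq0 expr0n/= => /esym/eqP; rewrite mulf_eq0 gt_eqF ?mulr_gt0//= => /eqP.
  rewrite d_eq0 q_eq0 mul0r addr0 leNgt; apply/negP => X0.
  have XK : 0 < X + K by rewrite addr_gt0.
  (* any s with s K < X refutes X > 0; this one is also at most 1 *)
  have := seg (X / (X + K)).
  rewrite divr_gt0// ler_pdivrMr// mul1r lerDl ltW// => /(_ isT).
  rewrite d_eq0 addr0 expr2 -mulrA ler_pM2l ?divr_gt0//.
  by rewrite mulrAC ler_pdivlMr// mulrDr gerDr leNgt mulr_gt0.
have qp : 0 < q by rewrite lt0r q_neq0.
have kD : 0 < kappa * D by rewrite mulr_gt0.
have := seg (q / (kappa * D)).
rewrite divr_gt0// ler_pdivrMr// mul1r ltW// => /(_ isT) h.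
have {}h : X <= q / 2 * D + delta * (kappa * D) / q.
  rewrite -(@ler_pM2l _ (q / (kappa * D))) ?divr_gt0//.
  apply: le_trans h _; rewrite /K le_eqVlt; apply/orP; left; apply/eqP.
  by field; rewrite !gt_eqF.
apply: le_trans h _.
have -> : delta * (kappa * D) / q = q / 2 * D.
  have -> : delta * (kappa * D) = q ^+ 2 / 2 * D by rewrite q2; field.
  by field.
suff -> : q / 2 * D + q / 2 * D = q * D by rewrite lerDl.
by field.
Qed.

Lemma exact_min_gap U f (kappa : R) v z :
  segment_closed U -> 0 < kappa -> weakly_convex_on U (- (kappa / 2)) f ->
  U v -> U z -> (forall w, U w -> f v <= f w) ->
  kappa / 2 * l2norm (z - v) ^+ 2 <= f z - f v.
Proof.
move=> Ucvx k0 fcvx Uv Uz fv.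
have fv0 w : U w -> f v <= f w + 0 by rewrite addr0; exact: fv.
have := approx_min_gap Ucvx k0 fcvx (lexx 0) Uv Uz fv0.
by rewrite mulr0 sqrtr0 mul0r !addr0; lra.
Qed.

End strong_convexity.

Section weakly_convex_theory.
Context {R : realType} {d : nat}.
Implicit Types (U : set 'rV[R]_d) (f : 'rV[R]_d -> R).

Lemma weakly_convexD U (r1 r2 : R) f1 f2 :
  weakly_convex_on U r1 f1 -> weakly_convex_on U r2 f2 ->
  weakly_convex_on U (r1 + r2) (fun z => f1 z + f2 z).
Proof.
move=> c1 c2 x y a Ux Uy a01.
apply: le_trans (lerD (c1 _ _ _ Ux Uy a01) (c2 _ _ _ Ux Uy a01)) _.
by rewrite le_eqVlt; apply/orP; left; apply/eqP; ring.
Qed.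

Lemma weakly_convex_sqr_dist U (k : R) w :
  weakly_convex_on U (- k) (fun z => k * l2norm (z - w) ^+ 2).
Proof.
move=> x y a _ _ _; rewrite l2norm_conv_sqr le_eqVlt; apply/orP; left.
by apply/eqP; ring.
Qed.

Lemma weakly_convex_comp_affine m U (h : 'rV[R]_m -> R) (b : R) p v (A : 'M[R]_(d, m)) :
  convex_function [set: 'rV[R]_m] h -> 0 <= b ->
  weakly_convex_on U 0 (fun z => b * h (p + (z - v) *m A)).
Proof.
move=> hc b0 x y a _ _ /andP[a0 a1].
rewrite !mul0r addr0 [a * _]mulrCA [(1 - a) * _]mulrCA -mulrDr ler_wpM2l//.
have -> : p + (a *: x + (1 - a) *: y - v) *m A =
    a *: (p + (x - v) *m A) + (1 - a) *: (p + (y - v) *m A).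
  rewrite !scalerDr !scalemxAl addrACA -scalerDl [a + _]addrC subrK scale1r.
  congr (p + _); rewrite -mulmxDl; congr (_ *m _).
  by rewrite !scalerBr addrACA -opprD -scalerDl [a + _]addrC subrK scale1r.
have a01 : (0 <= a <= 1) by rewrite a0.
have := hc (Itv01 a0 a1) (p + (x - v) *m A) (p + (y - v) *m A).
by rewrite !in_setT => /(_ isT isT).
Qed.

End weakly_convex_theory.

(** With r = 0 the linearization of c at w = a x + (1 - a) y gives a convex minorant
    of h o c on U that touches it at w. *)
Lemma convexity_constant_weakly_convex (R : realType) (d m : nat) (U : set 'rV[R]_d)
    (h : 'rV[R]_m -> R) (c : 'rV[R]_d -> 'rV[R]_m) :
  segment_closed U -> convex_function [set: 'rV[R]_m] h ->
  convexity_constant h c U 0 -> weakly_convex_on U 0 (h \o c).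
Proof.
move=> Ucvx h_convex cP x y a Ux Uy a01; rewrite /= !mul0r addr0.
set w := a *: x + (1 - a) *: y; have Uw : U w by exact: Ucvx.
have := weakly_convex_comp_affine (c w) w (jacobian c w) h_convex (@ler01 R) Ux Uy a01.
rewrite -/w subrr mul0mx addr0 !mul1r !mul0r addr0 => /le_trans; apply.
have /andP[a0 a1] := a01.
have hx := cP _ _ Ux Uw; have hy := cP _ _ Uy Uw.
rewrite !mul0r !addr0 in hx hy.
by rewrite lerD// ler_wpM2l// subr_ge0.
Qed.


(** * Existence of the proximal point *)

Section lipschitz_continuity.
Context {R : realType} {d m : nat}.

Lemma lipschitz2_continuous (K : R) (f : 'rV[R]_d -> R) :
  lipschitz2 K f -> continuous f.
Proof.
move=> fK x V /= /nbhs_ballP[e /= e0 eV].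
have Kp : 0 < `|K| * d%:R + 1 by rewrite ltr_wpDl// mulr_ge0.
have rp : 0 < e / (`|K| * d%:R + 1) by rewrite divr_gt0.
rewrite nbhs_simpl; apply/nbhs_ballP; exists (e / (`|K| * d%:R + 1)) => //= y.
rewrite mx_norm_ball /ball_ /= => xy; apply: eV; rewrite /ball/=.
apply: le_lt_trans (fK x y) _.
apply: le_lt_trans (ler_wpM2r (l2norm_ge0 _) (ler_norm K)) _.
apply: le_lt_trans (ler_wpM2l (normr_ge0 K) (l2norm_le_sum _)) _.
rewrite mulrA; apply: (@le_lt_trans _ _ ((`|K| * d%:R + 1) * `|x - y|)).
  by rewrite ler_wpM2r// lerDl.
by rewrite mulrC -ltr_pdivlMr.
Qed.

Lemma lipschitz2_comp_affine (L : R) (h : 'rV[R]_m -> R) p v (A : 'M[R]_(d, m)) :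
  0 <= L -> lipschitz2 L h ->
  lipschitz2 (L * opnorm A) (fun z => h (p + (z - v) *m A)).
Proof.
move=> L0 hL y z; apply: le_trans (hL _ _) _.
rewrite -mulrA ler_wpM2l// opprD addrACA subrr add0r -mulmxBl opprB addrA subrK.
exact: l2norm_mul_opnorm.
Qed.

End lipschitz_continuity.

Section extended_convex.
Context {R : realType} {d : nat}.
Variable g : 'rV[R]_d -> \bar R.
Hypotheses (g_proper : proper_fun g) (g_convex : convex_efun g).

Lemma fine_edom x : edom g x -> g x = (fine (g x))%:E.
Proof. by move=> gx; rewrite fineK// fin_numE (proj1 g_proper) lt_eqF. Qed.

Lemma convex_efun_fine x y (a : R) : edom g x -> edom g y -> 0 <= a <= 1 ->
  (g (a *: x + (1 - a) *: y) <=
   (a * fine (g x) + (1 - a) * fine (g y))%:E)%E.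
Proof.
move=> gx gy a01; apply: le_trans (g_convex _ _ a01) _.
by rewrite (fine_edom gx) (fine_edom gy) -!EFinM -EFinD.
Qed.

Lemma edom_segment_closed : segment_closed (edom g).
Proof.
move=> x y a gx gy a01; rewrite /edom/=.
by apply: le_lt_trans (convex_efun_fine gx gy a01) _; rewrite ltry.
Qed.

Lemma fine_weakly_convex : weakly_convex_on (edom g) 0 (fine \o g).
Proof.
move=> x y a gx gy a01; rewrite !mul0r addr0 -lee_fin /=.
rewrite -fine_edom; first exact: convex_efun_fine.
exact: edom_segment_closed.
Qed.

(** Properness makes the infimum finite as soon as it is approximately attained,
    so that the problem becomes one about real-valued functions on the domain. *)
Lemma approx_minimizerP (q : 'rV[R]_d -> R) (eps : R) v :
  approx_minimizer (fun z => g z + (q z)%:E)%E eps v ->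
  edom g v /\ forall w, edom g w -> fine (g v) + q v <= fine (g w) + q w + eps.
Proof.
move=> vmin.
have vle w : (g v + (q v)%:E <= g w + (q w)%:E + eps%:E)%E.
  by apply: le_trans vmin _; rewrite leeD2r// ereal_inf_lbound//; exists w.
have gv : edom g v.
  have [w gw] := proj2 g_proper; have := vle w.
  rewrite (fine_edom gw) -!EFinD => h; rewrite /edom/= ltey; apply/negP => /eqP gvy.
  by move: h; rewrite gvy.
by split=> // w gw; have := vle w; rewrite (fine_edom gw) (fine_edom gv) -!EFinD lee_fin.
Qed.

(** Midpoints force a minimizing sequence to be Cauchy: their values are at least
    the infimum I, whence kappa / 4 |z_n - z_k|^2 <= 1/(n+1) + 1/(k+1). The pairs
    (z_n, I + 1/(n+1) - q z_n) lie in the closed epigraph of g, hence so does their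
    limit. *)
Lemma argmin_strongly_convex (q : 'rV[R]_d -> R) (kappa b : R) :
  closed_fun g -> continuous q -> 0 < kappa ->
  weakly_convex_on (edom g) (- (kappa / 2)) (fun z => fine (g z) + q z) ->
  (forall w, edom g w -> b <= fine (g w) + q w) ->
  exists z, argmin (fun z => g z + (q z)%:E)%E z.
Proof.
move=> g_closed qc k0; set f := fun z => fine (g z) + q z => fc fb.
pose I := inf (f @` edom g).
have infE : has_inf (f @` edom g).
  split; first by have [w gw] := proj2 g_proper; exists (f w), w.
  by exists b => _ [w gw <-]; exact: fb.
have If w : edom g w -> I <= f w.
  by move=> gw; apply: ge_inf; [exact: (proj2 infE)|exists w].
have /choice[z zP] n : exists z, edom g z /\ f z < I + harmonic n.
  have [_ [w gw <-] fw] := inf_adherent (harmonic_gt0 n) infE.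
  by exists w.
have gap n k : kappa * l2norm (z n - z k) ^+ 2 <= 4 * (harmonic n + harmonic k).
  have h01 : 0 <= (2^-1 : R) <= 1 by rewrite invr_ge0 ler0n invf_le1 ?ler1n.
  have := fc _ _ _ (proj1 (zP n)) (proj1 (zP k)) h01.
  have := If _ (edom_segment_closed (proj1 (zP n)) (proj1 (zP k)) h01).
  have := proj2 (zP n); have := proj2 (zP k).
  move: (f _) (f (z n)) (f (z k)) (l2norm _ ^+ 2) => F Fn Fk D2.
  by lra.
have zcauchy : cauchy (z @ \oo).
  apply: cauchy_exP => e e0.
  have : \forall n \near \oo, harmonic n < kappa * e ^+ 2 / 8.
    by apply: (cvgr_lt 0); [exact: cvg_harmonic|rewrite divr_gt0// mulr_gt0// exprn_gt0].
  move=> [N _ HN]; exists (z N); exists N => // n /= Nn.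
  rewrite mx_norm_ball /ball_/=.
  apply: le_lt_trans (norm_le_l2norm _) _.
  rewrite -(@ltr_pXn2r _ 2)// ?nnegrE ?l2norm_ge0 ?ltW//.
  rewrite -(ltr_pM2l k0); apply: le_lt_trans (gap _ _) _.
  have hn : harmonic n < kappa * e ^+ 2 / 8 := HN _ Nn.
  have hN : harmonic N < kappa * e ^+ 2 / 8 := HN _ (leqnn N).
  by lra.
have [zs zzs] := (cvg_ex _).1 (cauchy_cvg _ zcauchy).
have gzs : (g zs <= (I - q zs)%:E)%E.
  have epi : forall l : 'rV[R]_d * R, (z n, I + harmonic n - q (z n)) @[n --> \oo] --> l ->
      (g l.1 <= l.2%:E)%E.
    apply: closed_cvg; first exact: g_closed.
    exists 0%N => // n _ /=; rewrite (fine_edom (proj1 (zP n))) lee_fin.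
    by rewrite lerBrDr; exact: ltW (proj2 (zP n)).
  apply: (epi (zs, I - q zs)).
  have level : I + harmonic n - q (z n) @[n --> \oo] --> I - q zs.
    apply: cvgB; last exact: (cvg_comp _ _ zzs (qc zs)).
    by rewrite -[X in _ --> X]addr0; apply: cvgD; [exact: cvg_cst|exact: cvg_harmonic].
  exact: (cvg_pair zzs level).
have gzs_dom : edom g zs by apply: le_lt_trans gzs _; rewrite ltry.
exists zs => w /=.
have [gw|] := pselect (edom g w); last first.
  move=> /negP; rewrite /edom/= -leNgt leye_eq => /eqP ->.
  by rewrite addye// leey.
rewrite (fine_edom gw) -EFinD; apply: (@le_trans _ _ I%:E); last first.
  by rewrite lee_fin; exact: If.
move: gzs; rewrite (fine_edom gzs_dom) -EFinD !lee_fin; lra.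
Qed.

End extended_convex.

(** * One step of the method *)

Section one_step.
Context {R : realType} {d m : nat}.
Variables (U : set 'rV[R]_d) (G : 'rV[R]_d -> R).
Variables (h : 'rV[R]_m -> R) (c : 'rV[R]_d -> 'rV[R]_m).
Variables (mu r rho : R).
Hypothesis U_segment : segment_closed U.
Hypothesis G_convex : weakly_convex_on U 0 G.
Hypothesis h_convex : convex_function [set: 'rV[R]_m] h.
Hypothesis model_upper : forall z y,
  h (c z) <= h (c y + (z - y) *m jacobian c y) + mu / 2 * l2norm (z - y) ^+ 2.
Hypothesis rhoP : weakly_convex_on U rho (h \o c).
Hypothesis rP : convexity_constant h c U r.

(** For every z the point a z + (1 - a) xp differs from y by a (z - vp), so the
    model minimized by x takes at that point the h-term of a times the model
    minimized by v at z. With z = v this term appears in the bound from x, and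
    cancels against the bound from v, in which z = xs. *)
Lemma accelerated_step (mut a eps delta : R) (xp vp x v xs : 'rV[R]_d) :
  let y := a *: vp + (1 - a) *: xp in
  let F z := G z + h (c z) in
  0 < mut -> 0 < a <= 1 -> 0 <= delta ->
  U xp -> U vp -> U v -> U xs ->
  (forall w, U w ->
     G x + (h (c y + (x - y) *m jacobian c y) + mut / 2 * l2norm (x - y) ^+ 2) <=
     G w + (h (c y + (w - y) *m jacobian c y) + mut / 2 * l2norm (w - y) ^+ 2)
     + eps) ->
  (forall w, U w ->
     G v + (a^-1 * h (c y + (v - vp) *m (a *: jacobian c y)) +
            mut * a / 2 * l2norm (v - vp) ^+ 2) <=
     G w + (a^-1 * h (c y + (w - vp) *m (a *: jacobian c y)) +
            mut * a / 2 * l2norm (w - vp) ^+ 2) + delta) ->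
  F x - F xs + (mut - mu) / 2 * l2norm (x - y) ^+ 2 <=
    (1 - a) * (F xp - F xs)
    + mut * a ^+ 2 / 2 * (l2norm (xs - vp) ^+ 2 - l2norm (xs - v) ^+ 2)
    + r / 2 * a ^+ 2 * l2norm (xs - vp) ^+ 2
    + rho * a * (1 - a) * l2norm (xs - xp) ^+ 2
    + eps + a * delta + a * (Num.sqrt (2 * (mut * a) * delta) * l2norm (xs - v)).
Proof.
move=> y F mut0 /andP[a0 a1] delta0 Uxp Uvp Uv Uxs x_min v_min.
have a01 : 0 <= a <= 1 by rewrite ltW.
have diff_y z : a *: z + (1 - a) *: xp - y = a *: (z - vp).
  by rewrite /y opprD addrACA subrr addr0 scalerBr.
have lin_y z : h (c y + (a *: z + (1 - a) *: xp - y) *m jacobian c y) =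
    h (c y + (z - vp) *m (a *: jacobian c y)).
  by rewrite diff_y -scalemxAl -scalemxAr.
have dist_y z : l2norm (a *: z + (1 - a) *: xp - y) ^+ 2 = a ^+ 2 * l2norm (z - vp) ^+ 2.
  by rewrite diff_y l2normZ exprMn real_normK// num_real.
have Uy : U y by exact: U_segment.
have := model_upper x y.
have := x_min _ (U_segment Uv Uxp a01); rewrite lin_y dist_y.
have := G_convex Uv Uxp a01; rewrite !mul0r addr0.
have k0 : 0 < mut * a by rewrite mulr_gt0.
have q_convex : weakly_convex_on U (- (mut * a / 2)) (fun z =>
    G z + (a^-1 * h (c y + (z - vp) *m (a *: jacobian c y)) +
           mut * a / 2 * l2norm (z - vp) ^+ 2)).
  rewrite -[X in weakly_convex_on _ X _]add0r; apply: weakly_convexD => //.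
  rewrite -[X in weakly_convex_on _ X _]add0r; apply: weakly_convexD.
    by apply: weakly_convex_comp_affine => //; rewrite invr_ge0 ltW.
  exact: weakly_convex_sqr_dist.
have := approx_min_gap U_segment k0 q_convex delta0 Uv Uxs v_min.
move=> /(ler_wpM2l (ltW a0)).
have := rP (U_segment Uxs Uxp a01) Uy; rewrite lin_y dist_y.
have := rhoP Uxs Uxp a01; rewrite /F /=.
move: (Num.sqrt _) => q.
move: (h (c y + (v - vp) *m _)) (h (c y + (xs - vp) *m _)) => Hv Hs.
move: (h (c y + (x - y) *m _)) (h (c (_ + _))) => Hx Hw.
move: (h (c x)) (h (c xs)) (h (c xp)) (G (_ + _)) => hx hxs hxp Gw.
move: (G x) (G xs) (G xp) (G v) => Gx Gxs Gxp Gv.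
move: (l2norm (xs - v)) (l2norm (xs - vp)) (l2norm (v - vp)) => n1 n2 n3.
move: (l2norm (x - y)) (l2norm (xs - xp)) => n4 n5.
clear - a0 => e1 e2 e3.
have ev : a * (Gv + (a^-1 * Hv + mut * a / 2 * n3 ^+ 2)) =
  a * Gv + Hv + mut * a ^+ 2 / 2 * n3 ^+ 2 by field; rewrite gt_eqF.
have e : a * (Gxs + (a^-1 * Hs + mut * a / 2 * n2 ^+ 2)
     - mut * a / 2 * n1 ^+ 2 + q * n1 + delta) =
  a * Gxs + Hs + mut * a ^+ 2 / 2 * n2 ^+ 2
     - mut * a ^+ 2 / 2 * n1 ^+ 2 + a * (q * n1) + a * delta.
  by field; rewrite gt_eqF.
move: e3; rewrite ev e.
lra.
Qed.

End one_step.


(** * Summing a perturbed recursion *)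

Section sequences.
Context {R : realType}.

Lemma le_of_sqr_le_cross (t S l : R) :
  0 <= S + l ^+ 2 -> t ^+ 2 <= S + 2 * l * t -> t <= l + Num.sqrt (S + l ^+ 2).
Proof.
move=> S0 tS; rewrite -lerBlDl; apply: le_trans (ler_norm _) _.
rewrite -sqrtr_sqr ler_wsqrtr//; move: tS; lra.
Qed.

(** The maximum t of the u_i satisfies t^2 <= S + 2 l t, with l the sum of the s_i. *)
Lemma le_of_cumulative_sqr_le (u s : nat -> R) (S : R) (N : nat) :
  (forall i, 0 <= u i) -> (forall i, (1 <= i)%N -> 0 <= s i) -> 0 <= S ->
  (forall k, (1 <= k <= N)%N ->
     u k ^+ 2 <= S + 2 * \sum_(1 <= i < k.+1) s i * u i) ->
  forall k, (1 <= k <= N)%N ->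
    u k <= \sum_(1 <= i < N.+1) s i
           + Num.sqrt (S + (\sum_(1 <= i < N.+1) s i) ^+ 2).
Proof.
move=> u0 s0 S0 uS; set l := \sum_(1 <= i < N.+1) s i.
have l0 : 0 <= l by rewrite /l big_nat sumr_ge0// => i /andP[/s0].
(* index 0 is masked: the hypothesis says nothing about u 0 *)
pose t := \big[Num.max/0]_(i < N.+1) (if (0 < i)%N then u i else 0).
have t0 : 0 <= t.
  by rewrite /t; elim/big_ind : _ => // [p q p0 q0|i _]; [rewrite le_max p0|case: ifP].
have ut k : (1 <= k <= N)%N -> u k <= t.
  move=> /andP[k1 kN].
  by have := le_bigmax 0 (fun i : 'I_N.+1 => if (0 < i)%N then u i else 0)
    (Ordinal (kN : (k < N.+1)%N)); rewrite /= k1.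
have usqr k : (1 <= k <= N)%N -> u k ^+ 2 <= S + 2 * l * t.
  move=> /andP[k1 kN]; apply: le_trans (uS k _) _; first by rewrite k1.
  rewrite lerD2l -mulrA ler_wpM2l// /l mulr_suml.
  rewrite [leRHS](big_cat_nat (n := k.+1))//=.
  rewrite -[leLHS]addr0 lerD//.
    rewrite [leLHS]big_nat [leRHS]big_nat; apply: ler_sum => i /andP[i1 ik].
    by rewrite ler_wpM2l ?s0// ut// i1 (leq_trans _ kN).
  rewrite big_nat sumr_ge0// => i /andP[ik _].
  by rewrite mulr_ge0// s0// (leq_trans k1)// ltnW.
have t_le : t <= l + Num.sqrt (S + l ^+ 2).
  apply: le_of_sqr_le_cross; first by rewrite addr_ge0// sqr_ge0.
  have lt0 : 0 <= S + 2 * l * t by rewrite addr_ge0// mulr_ge0// mulr_ge0.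
  rewrite -[leRHS]sqr_sqrtr// ler_pXn2r ?nnegrE ?sqrtr_ge0//.
  apply: bigmax_le; first exact: sqrtr_ge0.
  move=> [i iN] _ /=; case: ifP => [i1|_]; last exact: sqrtr_ge0.
  rewrite -(@ler_pXn2r _ 2)// ?nnegrE ?sqrtr_ge0// sqr_sqrtr// usqr//.
  by rewrite i1 -ltnS.
by move=> k kN; exact: le_trans (ut k kN) t_le.
Qed.

Lemma sum_sqr_quarter (N : nat) :
  \sum_(1 <= i < N.+1) (i%:R ^+ 2 / 4 : R) =
  N%:R * (N%:R + 1) * (2 * N%:R + 1) / 24.
Proof.
elim: N => [|N IH]; first by rewrite big_geq// !mul0r.
by rewrite big_nat_recr//= IH -[N.+1%:R]natr1; field.
Qed.

End sequences.

Section telescoping.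
Context {R : realType}.
Local Notation a := (@acc_weight R).

Lemma acc_weight_gt0 k : 0 < a k.
Proof. by rewrite divr_gt0. Qed.

Lemma acc_weight_le1 k : (1 <= k)%N -> a k <= 1.
Proof. by move=> k1; rewrite ler_pdivrMr// mul1r ler_nat. Qed.

(** In the first step gap 0 has weight 1 - a_1 = 0, hence the factor (0 < N) that
    removes it. *)
Lemma telescoped_bound (gap u p kap e delta : nat -> R) (mut nu : R) :
  0 < mut ->
  (forall k, (1 <= k)%N -> 0 <= gap k) ->
  (forall k, (1 <= k)%N ->
     gap k + nu * p k <=
     (1 - a k) * gap k.-1 + mut * a k ^+ 2 / 2 * (u k.-1 ^+ 2 - u k ^+ 2)
     + a k ^+ 2 * kap k + e k
     + a k * (Num.sqrt (2 * (mut * a k) * delta k) * u k)) ->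
  forall N,
    (0 < N)%N%:R * (gap N / a N ^+ 2) + mut / 2 * u N ^+ 2
      + nu * \sum_(1 <= i < N.+1) p i / a i ^+ 2 <=
    mut / 2 * u 0%N ^+ 2 + \sum_(1 <= i < N.+1) kap i
      + \sum_(1 <= i < N.+1) e i / a i ^+ 2
      + Num.sqrt (2 * mut) * \sum_(1 <= i < N.+1) Num.sqrt (delta i / a i) * u i.
Proof.
move=> mut0 gap0 step; elim=> [|N IH].
  by rewrite !big_geq//= mul0r !mulr0 !addr0 add0r.
have -> : (0 < N.+1)%N%:R = 1 :> R by [].
have recr (F : nat -> R) :
  \sum_(1 <= i < N.+2) F i = \sum_(1 <= i < N.+1) F i + F N.+1.
  by rewrite big_nat_recr.
rewrite !recr mul1r.
have aN0 := acc_weight_gt0 N.+1.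
have := step N.+1 isT; rewrite /=.
have -> : Num.sqrt (2 * (mut * a N.+1) * delta N.+1) =
    Num.sqrt (2 * mut) * (a N.+1 * Num.sqrt (delta N.+1 / a N.+1)).
  rewrite -{2}[a N.+1]ger0_norm ?ltW// -sqrtr_sqr -sqrtrM ?sqr_ge0//.
  rewrite -sqrtrM ?mulr_ge0 ?ltW//; congr Num.sqrt; field.
  by rewrite gt_eqF.
(* the inequality (n^2 - 1) / 4 <= n^2 / 4 behind the choice of the weights *)
have prev : (1 - a N.+1) / a N.+1 ^+ 2 * gap N <= (0 < N)%N%:R * (gap N / a N ^+ 2).
  case: N {IH step aN0 recr} => [|N]; first by rewrite /acc_weight divff// subrr !mul0r.
  have -> : (0 < N.+1)%N%:R = 1 :> R by [].
  rewrite mul1r mulrC ler_wpM2l ?gap0// /acc_weight.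
  have n2 : 0 <= N.+2%:R :> R by [].
  have -> : N.+3%:R = N.+2%:R + 1 :> R by rewrite natr1.
  have -> : (1 - 2 / (N.+2%:R + 1)) / (2 / (N.+2%:R + 1)) ^+ 2 =
      (N.+2%:R ^+ 2 - 1) / 4 :> R.
    by field; rewrite gt_eqF// ltr_wpDl.
  have -> : (2 / N.+2%:R) ^- 2 = N.+2%:R ^+ 2 / 4 :> R by field; rewrite gt_eqF.
  by rewrite ler_wpM2r ?invr_ge0// gerBl.
have A0 : 0 <= (a N.+1 ^+ 2)^-1 by rewrite invr_ge0 sqr_ge0.
move=> /(ler_wpM2l A0).
move: (a N.+1) (Num.sqrt (_ / _)) aN0 prev => b sd b0 prev.
move: IH prev.
move: (Num.sqrt (2 * mut)) ((0 < N)%N%:R * (gap N / a N ^+ 2)) => sm V.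
move: (gap N) (gap N.+1) (p N.+1) (u N) (u N.+1) => gN gN1 pN uN uN1.
move: (kap _) (e _) (\sum_(_ <= i < _) p i / _) (\sum_(_ <= i < _) kap i) => k1 e1 P K.
move: (\sum_(_ <= i < _) e i / _) (\sum_(_ <= i < _) _ * u i) => E W IH prev.
have -> : (b ^+ 2)^-1 * (gN1 + nu * pN) = gN1 / b ^+ 2 + nu * (pN / b ^+ 2).
  by field; rewrite gt_eqF.
have -> : (b ^+ 2)^-1 * ((1 - b) * gN + mut * b ^+ 2 / 2 * (uN ^+ 2 - uN1 ^+ 2) +
     b ^+ 2 * k1 + e1 + b * (sm * (b * sd) * uN1)) =
   (1 - b) / b ^+ 2 * gN + mut / 2 * (uN ^+ 2 - uN1 ^+ 2) + k1 + e1 / b ^+ 2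
   + sm * (sd * uN1) by field; rewrite gt_eqF.
move: IH prev; move: ((1 - b) / _) (pN / _) (gN1 / _) (e1 / _) (uN ^+ 2) (uN1 ^+ 2) => ? ? ? ? ? ?.
lra.
Qed.

Lemma bigmin_seq_le (I : eqType) (s : seq I) (x0 : R) (F : I -> R) j :
  j \in s -> \big[Num.min/x0]_(i <- s) F i <= F j.
Proof.
elim: s => // i s IH; rewrite inE big_cons ge_min => /orP[/eqP <-|/IH ->].
  by rewrite lexx.
by rewrite orbT.
Qed.

End telescoping.

(** * Bounds along the iterates *)

Lemma half_invV (R : realType) (t : R) : (2 * t^-1)^-1 = t / 2.
Proof. by rewrite invfM invrK mulrC. Qed.

Section method.
Context {R : realType} {d m : nat}.
Variables (g : 'rV[R]_d -> \bar R) (h : 'rV[R]_m -> R) (c : 'rV[R]_d -> 'rV[R]_m).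
Variables (L beta rho r mut M : R) (eps delta : nat -> R) (x v : nat -> 'rV[R]_d).
Variable xs : 'rV[R]_d.
Hypotheses (g_proper : proper_fun g) (g_closed : closed_fun g).
Hypotheses (g_convex : convex_efun g) (L_ge0 : 0 <= L).
Hypotheses (h_convex : convex_function [set: 'rV[R]_m] h) (h_lip : lipschitz2 L h).
Hypotheses (beta_ge0 : 0 <= beta) (c_C1 : C1_smooth c).
Hypotheses (c_lip : jacobian_lipschitz beta c) (mut_gt : L * beta < mut).
Hypotheses (rhoP : weakly_convex_on (edom g) rho (h \o c)).
Hypotheses (rP : convexity_constant h c (edom g) r).
Hypotheses (rho_ge0 : 0 <= rho) (r_ge0 : 0 <= r).
Hypotheses (eps_ge0 : forall i, (1 <= i)%N -> 0 <= eps i).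
Hypotheses (delta_ge0 : forall i, (1 <= i)%N -> 0 <= delta i).
Hypothesis xvP : inexact_acc_prox_linear g h c mut eps delta x v.
Hypothesis xsP :
  forall k, (1 <= k)%N -> (composite g h c xs <= composite g h c (x k))%E.
(* Stated with the factors r and rho so that M = 0 is allowed when both vanish,
   whatever the diameter of the domain. *)
Hypothesis rM : forall z w, edom g z -> edom g w ->
  r * l2norm (z - w) ^+ 2 <= r * M ^+ 2.
Hypothesis rhoM : forall z w, edom g z -> edom g w ->
  rho * l2norm (z - w) ^+ 2 <= rho * M ^+ 2.

Local Notation U := (edom g).
Local Notation G := (fine \o g).
Local Notation mu := (L * beta).
Local Notation a := (@acc_weight R).
Local Notation y := (acc_point x v).
Local Notation F z := (fine (g z) + h (c z)).

Let prox_q k z := h (c (y k) + (z - y k) *m jacobian c (y k))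
  + mut / 2 * l2norm (z - y k) ^+ 2.
Let acc_q k z := (a k)^-1 * h (c (y k) + (z - v k.-1) *m (a k *: jacobian c (y k)))
  + mut * a k / 2 * l2norm (z - v k.-1) ^+ 2.

Lemma mut_gt0 : 0 < mut.
Proof. by apply: le_lt_trans mut_gt; exact: mulr_ge0. Qed.

Lemma model_upper z w :
  h (c z) <= h (c w + (z - w) *m jacobian c w) + mu / 2 * l2norm (z - w) ^+ 2.
Proof.
rewrite -lerBlDl; apply: le_trans (ler_norm _) _.
apply: le_trans (h_lip _ _) _; rewrite -!mulrA ler_wpM2l// mulrA.
exact: linearization_error.
Qed.

Lemma prox_modelE k :
  prox_model g h c mut^-1 (y k) = (fun z => g z + (prox_q k z)%:E)%E.
Proof.
by apply/funext => z; rewrite /prox_model /prox_q half_invV.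
Qed.

Lemma acc_modelE k :
  acc_model g h c (mut * a k)^-1 (a k) (y k) (v k.-1) =
  (fun z => g z + (acc_q k z)%:E)%E.
Proof.
apply/funext => z; rewrite /acc_model /acc_q -scalemxAr.
by rewrite (half_invV (mut * a k)).
Qed.

Lemma x_step k : (1 <= k)%N ->
  U (x k) /\ forall w, U w -> G (x k) + prox_q k (x k) <= G w + prox_q k w + eps k.
Proof.
move=> k1; have [_ _ /(_ k k1) [+ _]] := xvP.
by rewrite prox_modelE => /(approx_minimizerP g_proper).
Qed.

Lemma v_step k : (1 <= k)%N ->
  U (v k) /\ forall w, U w -> G (v k) + acc_q k (v k) <= G w + acc_q k w + delta k.
Proof.
move=> k1; have [_ _ /(_ k k1) [_ +]] := xvP.
by rewrite acc_modelE => /(approx_minimizerP g_proper).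
Qed.

Lemma x_edom k : U (x k).
Proof. by case: k => [|k]; [case: xvP|case: (@x_step k.+1 isT)]. Qed.

Lemma v_edom k : U (v k).
Proof. by case: k => [|k]; [case: xvP|case: (@v_step k.+1 isT)]. Qed.

Lemma compositeE z : U z -> composite g h c z = (F z)%:E.
Proof. by move=> Uz; rewrite /composite (fine_edom g_proper Uz) -EFinD. Qed.

Lemma xs_edom : U xs.
Proof.
have := xsP (leqnn 1); rewrite (compositeE (x_edom 1)) /composite /edom/= => h1.
by rewrite ltey; apply/negP => /eqP gy; move: h1; rewrite gy.
Qed.

Lemma gap_ge0 k : (1 <= k)%N -> 0 <= F (x k) - F xs.
Proof.
move=> /xsP; rewrite (compositeE xs_edom) (compositeE (x_edom k)) lee_fin.
by rewrite subr_ge0.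
Qed.

Lemma method_step k : (1 <= k)%N ->
  F (x k) - F xs + (mut - mu) / 2 * l2norm (x k - y k) ^+ 2 <=
    (1 - a k) * (F (x k.-1) - F xs)
    + mut * a k ^+ 2 / 2 * (l2norm (xs - v k.-1) ^+ 2 - l2norm (xs - v k) ^+ 2)
    + a k ^+ 2 * (M ^+ 2 * (r / 2 + rho / 2 * (k%:R - 1)))
    + (delta k * a k + 1 * eps k)
    + a k * (Num.sqrt (2 * (mut * a k) * delta k) * l2norm (xs - v k)).
Proof.
move=> k1; have a0 := @acc_weight_gt0 R k.
have a01 : 0 < a k <= 1 by rewrite a0 acc_weight_le1.
have [_ xmin] := x_step k1; have [_ vmin] := v_step k1.
have := accelerated_step (@edom_segment_closed _ _ _ g_proper g_convex)
  (fine_weakly_convex g_proper g_convex) h_convex model_upper rhoP rP mut_gt0 a01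
  (delta_ge0 k1) (x_edom k.-1) (v_edom k.-1) (v_edom k) xs_edom xmin vmin.
(* (1 - a_k) / a_k = (k - 1) / 2: the term in rho grows with k *)
have acc_complement : a k * (1 - a k) = a k ^+ 2 * ((k%:R - 1) / 2).
  by rewrite /acc_weight -natr1; field; rewrite gt_eqF//; have := ler0n R k; lra.
rewrite -[rho * a k * _]mulrA acc_complement.
have a2 : 0 <= a k ^+ 2 / 2 by rewrite divr_ge0// sqr_ge0.
have ak : 0 <= a k ^+ 2 * ((k%:R - 1) / 2).
  by rewrite mulr_ge0 ?sqr_ge0// divr_ge0// subr_ge0 ler1n.
have := ler_wpM2l a2 (rM xs_edom (v_edom k.-1)).
have := ler_wpM2l ak (rhoM xs_edom (x_edom k.-1)).
rewrite /=; lra.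
Qed.

Local Notation u k := (l2norm (xs - v k)).
Local Notation D := (l2norm (xs - v 0%N)).
Local Notation K N := (M ^+ 2 * (r + rho / 2 * (N%:R + 3))).
Local Notation sqd i := (Num.sqrt (delta i / a i)).
Local Notation displacement N :=
  (\sum_(1 <= i < N.+1) l2norm (x i - y i) ^+ 2 / a i ^+ 2).

Lemma K_ge0 N : 0 <= K N.
Proof.
by rewrite mulr_ge0 ?sqr_ge0// addr_ge0// mulr_ge0 ?divr_ge0// addr_ge0.
Qed.

(** The sum is M^2 (r k + rho / 2 * k (k - 1)) / 2. *)
Lemma sum_nonconvexity k N : (k <= N)%N ->
  \sum_(1 <= i < k.+1) M ^+ 2 * (r / 2 + rho / 2 * (i%:R - 1)) <= N%:R * K N / 2.
Proof.
move=> kN.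
have -> : \sum_(1 <= i < k.+1) M ^+ 2 * (r / 2 + rho / 2 * (i%:R - 1)) =
    M ^+ 2 * (r * k%:R + rho / 2 * (k%:R * (k%:R - 1))) / 2.
  elim: k {kN} => [|k IH]; first by rewrite big_geq// !(mul0r, mulr0, addr0).
  by rewrite big_nat_recr//= IH -natr1; field.
rewrite ler_wpM2r ?invr_ge0// [leRHS]mulrCA ler_wpM2l ?sqr_ge0//.
have kN' : k%:R <= N%:R :> R by rewrite ler_nat.
have k0 : 0 <= k%:R :> R by [].
move: (k%:R : R) (N%:R : R) kN' k0 => p q pq p0.
have pq2 : p * (p - 1) <= q * (q + 3) by nra.
have := ler_wpM2l r_ge0 pq; have := ler_wpM2l rho_ge0 pq2.
lra.
Qed.

Lemma err_term_ge0 q i : 0 <= q -> (1 <= i)%N ->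
  0 <= (delta i * a i + q * eps i) / a i ^+ 2.
Proof.
move=> q0 i1; rewrite divr_ge0 ?sqr_ge0// addr_ge0// mulr_ge0 ?delta_ge0 ?eps_ge0//.
by rewrite ltW// acc_weight_gt0.
Qed.

Lemma sum_err_mono q1 q2 k N : 0 <= q1 -> q1 <= q2 -> (k <= N)%N ->
  sum_err q1 eps delta k <= sum_err q2 eps delta N.
Proof.
move=> q10 q12 kN; rewrite /sum_err [leRHS](big_cat_nat (n := k.+1))//=.
rewrite -[leLHS]addr0 lerD//.
  rewrite [leLHS]big_nat [leRHS]big_nat; apply: ler_sum => i /andP[i1 _].
  by rewrite ler_wpM2r ?invr_ge0 ?sqr_ge0// lerD2l ler_wpM2r ?eps_ge0.
rewrite big_nat sumr_ge0// => i /andP[ki _].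
by rewrite err_term_ge0 ?(le_trans q10)// (leq_trans _ ki).
Qed.

Lemma sum_err_ge0 q N : 0 <= q -> 0 <= sum_err q eps delta N.
Proof.
by move=> q0; rewrite /sum_err big_nat sumr_ge0// => i /andP[i1 _]; exact: err_term_ge0.
Qed.

Lemma displacement_ge0 N : 0 <= displacement N.
Proof. by apply: sumr_ge0 => i _; rewrite divr_ge0 ?sqr_ge0. Qed.

(** The right-hand side is taken at N rather than at k so that it is the same for
    all k <= N, as the quadratic inequality for the distances requires. *)
Lemma cumulative_bound k N : (k <= N)%N ->
  (0 < k)%N%:R * ((F (x k) - F xs) / a k ^+ 2) + mut / 2 * u k ^+ 2
    + (mut - mu) / 2 * displacement k <=
  mut / 2 * D ^+ 2 + N%:R * K N / 2 + sum_err 1 eps delta N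
    + Num.sqrt (2 * mut) * \sum_(1 <= i < k.+1) sqd i * u i.
Proof.
move=> kN.
have := telescoped_bound mut_gt0 gap_ge0 method_step k.
move=> /le_trans; apply; rewrite lerD2r lerD//; last exact: sum_err_mono.
by rewrite lerD2l sum_nonconvexity.
Qed.

(** Dropping the two other nonnegative terms of cumulative_bound leaves the
    quadratic inequality of le_of_cumulative_sqr_le, with s_i the square root of
    2 delta_i / (mut a_i). *)
Lemma distance_bound k N : (1 <= k <= N)%N -> u k <= err_A mut D (K N) eps delta N.
Proof.
move=> kN; have mut0 := mut_gt0.
pose s i := Num.sqrt (2 / mut) * sqd i.
have s_sum : \sum_(1 <= i < N.+1) s i = Num.sqrt (2 / mut) * sum_sqrt_delta delta N.
  by rewrite -mulr_sumr.
have sqrt_ratio : Num.sqrt (2 * mut) = mut * Num.sqrt (2 / mut).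
  rewrite -{2}[mut]ger0_norm ?ltW// -sqrtr_sqr -sqrtrM ?sqr_ge0//.
  by congr Num.sqrt; field; rewrite gt_eqF.
rewrite /err_A.
have -> : 2 / mut * sum_sqrt_delta delta N ^+ 2 = (\sum_(1 <= i < N.+1) s i) ^+ 2.
  by rewrite s_sum exprMn sqr_sqrtr// divr_ge0// ltW.
rewrite -s_sum; apply: (@le_of_cumulative_sqr_le _ (fun i => u i)) kN => [i|i _||{}k /andP[k1 kN]].
- exact: l2norm_ge0.
- by rewrite mulr_ge0 ?sqrtr_ge0.
- rewrite addr_ge0//; last by rewrite mulr_ge0 ?divr_ge0 ?sum_err_ge0// ltW.
  rewrite addr_ge0 ?sqr_ge0//; apply: divr_ge0; last exact: ltW.
  by apply: mulr_ge0; [|exact: K_ge0].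
- have := cumulative_bound kN.
  have -> : \sum_(1 <= i < k.+1) s i * u i =
      Num.sqrt (2 / mut) * \sum_(1 <= i < k.+1) sqd i * u i.
    by rewrite mulr_sumr; apply: eq_bigr => i _; rewrite mulrA.
  have gap0 : 0 <= (0 < k)%N%:R * ((F (x k) - F xs) / a k ^+ 2).
    by rewrite mulr_ge0// divr_ge0 ?sqr_ge0// gap_ge0.
  have disp0 : 0 <= (mut - mu) / 2 * displacement k.
    by rewrite mulr_ge0 ?displacement_ge0// divr_ge0// subr_ge0 ltW.
  have err12 : sum_err 1 eps delta N <= sum_err 2 eps delta N.
    by rewrite sum_err_mono// ler1n.
  rewrite sqrt_ratio.
  move: gap0 disp0 err12; move: (_%:R * (_ / _)) (_ * displacement k) => V1 V2.
  move: (sum_err 1 _ _ _) (sum_err 2 _ _ _) (\sum_(_ <= i < _) _) => e1 e2 W.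
  move: (Num.sqrt _) (u k ^+ 2) (D ^+ 2) (N%:R * K N) => q u2 D2 NK h1 h2 h3 h4.
  rewrite -(ler_pM2l (_ : 0 < mut / 2)) ?divr_gt0//.
  have -> : mut / 2 * (D2 + NK / mut + 2 / mut * e2 + 2 * (q * W)) =
     mut / 2 * D2 + NK / 2 + e2 + mut * q * W by field; rewrite gt_eqF.
  by lra.
Qed.

Lemma energy_bound N : (1 <= N)%N ->
  (F (x N) - F xs) / a N ^+ 2 + (mut - mu) / 2 * displacement N <=
  mut / 2 * D ^+ 2 + N%:R * K N / 2 + sum_err 1 eps delta N
    + err_A mut D (K N) eps delta N * Num.sqrt (2 * mut) * sum_sqrt_delta delta N.
Proof.
move=> N1; have := cumulative_bound (leqnn N).
have -> : (0 < N)%N%:R = 1 :> R by rewrite N1.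
rewrite mul1r.
have : \sum_(1 <= i < N.+1) sqd i * u i <=
    err_A mut D (K N) eps delta N * sum_sqrt_delta delta N.
  rewrite /sum_sqrt_delta mulr_sumr big_nat [leRHS]big_nat.
  apply: ler_sum => i iN; rewrite mulrC ler_wpM2r ?sqrtr_ge0//.
  by apply: distance_bound; rewrite -ltnS.
move=> /(ler_wpM2l (sqrtr_ge0 (2 * mut))).
have : 0 <= mut / 2 * u N ^+ 2 by rewrite mulr_ge0 ?sqr_ge0// divr_ge0// ltW// mut_gt0.
lra.
Qed.

Lemma value_gap_bound N : (1 <= N)%N -> K N = 0 ->
  F (x N) - F xs <= value_bound mut D 0 eps delta N.
Proof.
move=> N1 KN0; have := energy_bound N1; rewrite KN0 mulr0 mul0r addr0.
have disp0 : 0 <= (mut - mu) / 2 * displacement N.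
  by rewrite mulr_ge0 ?displacement_ge0// divr_ge0// subr_ge0 ltW.
have err12 : sum_err 1 eps delta N <= sum_err 2 eps delta N.
  by rewrite sum_err_mono// ler1n.
have N0 : 0 < N%:R + 1 :> R by rewrite ltr_wpDl.
rewrite /value_bound ler_pdivlMr ?exprn_gt0//.
have -> : (a N ^+ 2)^-1 = (N%:R + 1) ^+ 2 / 4.
  by rewrite /acc_weight -natr1; field; rewrite gt_eqF.
move: disp0 err12; move: (_ * displacement N) (F (x N) - F xs) (err_A _ _ _ _ _ _).
move: (sum_err _ _ _ _) (sum_err _ _ _ _) => *.
lra.
Qed.

Lemma prox_q_strongly_convex k :
  weakly_convex_on U (- (mut / 2)) (fun z => G z + prox_q k z).
Proof.
rewrite -[X in weakly_convex_on _ X _]add0r; apply: weakly_convexD.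
  exact: fine_weakly_convex.
rewrite -[X in weakly_convex_on _ X _]add0r; apply: weakly_convexD.
  have := @weakly_convex_comp_affine _ _ _ U h 1 (c (y k)) (y k) (jacobian c (y k)) h_convex ler01.
  by under [X in weakly_convex_on _ _ X -> _]eq_fun do rewrite mul1r.
exact: weakly_convex_sqr_dist.
Qed.

Lemma prox_q_continuous k : continuous (prox_q k).
Proof.
have lin_c : continuous (fun w : 'rV[R]_d => h (c (y k) + (w - y k) *m jacobian c (y k))).
  exact: lipschitz2_continuous (lipschitz2_comp_affine _ _ _ L_ge0 h_lip).
have dist_c : continuous (fun w : 'rV[R]_d => l2norm (w - y k)).
  exact: lipschitz2_continuous (lipschitz2_l2dist (y k)).
move=> z.
exact: (cvgD (lin_c z) (cvgM (cvg_cst (mut / 2)) (cvgM (dist_c z) (dist_c z)))).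
Qed.

(** The proximal point exists, so the default value in its definition is not met,
    and it minimizes a mut-strongly convex model for which x_k is eps_k-optimal. *)
Lemma prox_step_gap k : (1 <= k)%N ->
  mut / 2 * l2norm (x k - prox_step g h c mut^-1 (y k)) ^+ 2 <= eps k.
Proof.
move=> k1; have [Ux xmin] := x_step k1.
have fb w : U w -> fine (g (x k)) + prox_q k (x k) - eps k <= fine (g w) + prox_q k w.
  by move=> Uw; rewrite lerBlDr xmin.
have exP := argmin_strongly_convex g_proper g_convex g_closed (@prox_q_continuous k)
  mut_gt0 (prox_q_strongly_convex k) fb.
have := xgetPex 0 exP; rewrite -prox_modelE -/(prox_step _ _ _ _ _).
set P := prox_step _ _ _ _ _; rewrite prox_modelE => Pmin.
have [UP Pmin'] : U P /\ forall w, U w -> G P + prox_q k P <= G w + prox_q k w + 0.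
  apply: approx_minimizerP => //; rewrite /approx_minimizer adde0.
  by apply: le_ereal_inf_tmp => _ [w _ <-]; exact: Pmin.
have Pmin0 w : U w -> G P + prox_q k P <= G w + prox_q k w.
  by move=> /Pmin'; rewrite addr0.
apply: le_trans (exact_min_gap (@edom_segment_closed _ _ _ g_proper g_convex) mut_gt0
  (prox_q_strongly_convex k) UP Ux Pmin0) _.
by rewrite lerBlDl; exact: xmin.
Qed.

Local Notation G2 i := (l2norm (prox_gradient g h c mut^-1 (y i)) ^+ 2).

Lemma prox_gradient_sqr_le i : (1 <= i)%N ->
  G2 i <= 2 * mut ^+ 2 * l2norm (x i - y i) ^+ 2 + 4 * mut * eps i.
Proof.
move=> i1; have := prox_step_gap i1.
rewrite /prox_gradient invrK l2normZ exprMn real_normK ?num_real//.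
have := l2norm_sqrB_le (y i) (prox_step g h c mut^-1 (y i)) (x i).
rewrite [l2norm (y i - x i)]l2normB.
move: (l2norm _ ^+ 2) (l2norm _ ^+ 2) (l2norm _ ^+ 2) => p1 p2 p3 h1 h2.
have := ler_wpM2l (sqr_ge0 mut) h1.
have := ler_wpM2l (ltW mut_gt0) h2.
lra.
Qed.

(** The minimum is weighted by i^2 / 4 <= 1 / a_i^2, whose sum is explicit. *)
Lemma stationarity_gap_bound N : (1 <= N)%N ->
  \big[Num.min/G2 1%N]_(1 <= i < N.+1) G2 i <=
    stationarity_bound mu mut D (K N) eps delta N.
Proof.
move=> N1; set mn := \big[_/_]_(_ <= _ < _) _.
have mut0 := mut_gt0.
have nu0 : 0 < mut - mu by rewrite subr_gt0.
have n0 : 0 < N%:R :> R by rewrite ltr0n.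
have mn_le i : (1 <= i < N.+1)%N -> mn <= G2 i.
  by move=> iN; apply: bigmin_seq_le; rewrite mem_index_iota.
have weighted : mn * (N%:R * (N%:R + 1) * (2 * N%:R + 1) / 24) <=
    2 * mut ^+ 2 * displacement N
    + 4 * mut * (sum_err 3 eps delta N - sum_err 2 eps delta N).
  rewrite -sum_sqr_quarter /sum_err -sumrB !mulr_sumr -big_split/=.
  rewrite big_nat [leRHS]big_nat; apply: ler_sum => i iN.
  have i1 : (1 <= i)%N by case/andP: iN.
  have ai : (a i ^+ 2)^-1 = (i%:R + 1) ^+ 2 / 4.
    by rewrite /acc_weight -natr1; field; rewrite gt_eqF// ltr_wpDl.
  apply: (@le_trans _ _ (G2 i * (a i ^+ 2)^-1)).
    apply: (@le_trans _ _ (G2 i * (i%:R ^+ 2 / 4))).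
      by rewrite ler_wpM2r ?mn_le// divr_ge0 ?sqr_ge0.
    rewrite ai ler_wpM2l ?sqr_ge0// ler_wpM2r ?invr_ge0//.
    by rewrite ler_pXn2r ?nnegrE ?addr_ge0// lerDl.
  have A0 : 0 <= (a i ^+ 2)^-1 by rewrite invr_ge0 sqr_ge0.
  have := ler_wpM2r A0 (prox_gradient_sqr_le i1).
  by lra.
have := energy_bound N1.
have gap0 : 0 <= (F (x N) - F xs) / a N ^+ 2 by rewrite divr_ge0 ?sqr_ge0// gap_ge0.
have err12 : sum_err 1 eps delta N <= sum_err 2 eps delta N.
  by rewrite sum_err_mono// ler1n.
have err23 : sum_err 2 eps delta N <= sum_err 3 eps delta N.
  by rewrite sum_err_mono// ler_nat.
rewrite /stationarity_bound.
move: weighted gap0 err12 err23.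
move: (_ / a N ^+ 2) (displacement N) (err_A _ _ _ _ _ _) (sum_sqrt_delta _ _).
move: (sum_err 1 _ _ _) (sum_err 2 _ _ _) (sum_err 3 _ _ _) (Num.sqrt _) (K N).
move: (D ^+ 2) => D2 e1 e2 e3 q KN V P A S weighted V0 e12 e23 energy.
have c0 : 0 < N%:R * (N%:R + 1) * (2 * N%:R + 1) / 24 :> R.
  by rewrite divr_gt0// !mulr_gt0// ltr_wpDl// mulr_ge0.
rewrite -(ler_pM2r c0); apply: le_trans weighted _.
have -> : 96 * mut ^+ 2 / (mut - mu) *
  (mut * D2 / (2 * N%:R * (N%:R + 1) * (2 * N%:R + 1)) +
   KN / (2 * (N%:R + 1) * (2 * N%:R + 1)) +
   (e3 + A * q * S) / (N%:R * (N%:R + 1) * (2 * N%:R + 1))) *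
  (N%:R * (N%:R + 1) * (2 * N%:R + 1) / 24) =
  4 * mut ^+ 2 * (mut / 2 * D2 + N%:R * KN / 2 + A * q * S + e3) / (mut - mu).
  by field; rewrite !gt_eqF.
rewrite ler_pdivlMr//.
have mu0 : 0 <= mu by exact: mulr_ge0.
have := ler_wpM2l (mulr_ge0 (ler0n R 4) (sqr_ge0 mut)) energy.
have := mulr_ge0 (ltW mut0) (mulr_ge0 mu0 (_ : 0 <= e3 - e2)).
rewrite subr_ge0 => /(_ e23).
have := mulr_ge0 (sqr_ge0 mut) V0.
have := mulr_ge0 (sqr_ge0 mut) (_ : 0 <= e2 - e1).
rewrite subr_ge0 => /(_ e12).
move: (L * beta) => mu'; lra.
Qed.

End method.

Theorem theorem8p9 (R : realType) (d m : nat)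
    (g : 'rV[R]_d -> \bar R) (h : 'rV[R]_m -> R) (c : 'rV[R]_d -> 'rV[R]_m)
    (L beta rho r mut : R) (eps delta : nat -> R) (x v : nat -> 'rV[R]_d)
    (xs : 'rV[R]_d)
    (g_proper : proper_fun g) (g_closed : closed_fun g) (g_convex : convex_efun g)
    (L_ge0 : 0 <= L) (h_convex : convex_function [set: 'rV[R]_m] h)
    (h_lip : lipschitz2 L h)
    (beta_ge0 : 0 <= beta) (c_C1 : C1_smooth c) (c_lip : jacobian_lipschitz beta c)
    (rho_ge0 : 0 <= rho) (rhoP : weakly_convex_on (edom g) rho (h \o c))
    (r_ge0 : 0 <= r) (rP : convexity_constant h c (edom g) r)
    (mut_gt : L * beta < mut)
    (eps_ge0 : forall i, (1 <= i)%N -> 0 <= eps i)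
    (delta_ge0 : forall i, (1 <= i)%N -> 0 <= delta i)
    (xvP : inexact_acc_prox_linear g h c mut eps delta x v)
    (xsP : forall k, (1 <= k)%N -> (composite g h c xs <= composite g h c (x k))%E) :
  let G2 i := l2norm (prox_gradient g h c mut^-1 (acc_point x v i)) ^+ 2 in
  let D := l2norm (xs - v 0%N) in
  (forall M : R, diameter (edom g) = M%:E ->
   forall N : nat, (1 <= N)%N ->
     \big[Num.min/G2 1%N]_(1 <= i < N.+1) G2 i <=
       stationarity_bound (L * beta) mut D
         (M ^+ 2 * (r + rho / 2 * (N%:R + 3))) eps delta N)
  /\
  (r = 0 ->
   forall N : nat, (1 <= N)%N ->
     \big[Num.min/G2 1%N]_(1 <= i < N.+1) G2 i <=
       stationarity_bound (L * beta) mut D 0 eps delta N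
     /\ (composite g h c (x N) - composite g h c xs <=
         (value_bound mut D 0 eps delta N)%:E)%E).
Proof.
move=> G2 D; split=> [M diamM N N1|r0 N N1].
  have sqr_le (s : R) z w : 0 <= s -> edom g z -> edom g w ->
      s * l2norm (z - w) ^+ 2 <= s * M ^+ 2.
    move=> s0 gz gw; rewrite ler_wpM2l// lerXn2r ?nnegrE ?l2norm_ge0//.
      rewrite -lee_fin -diamM; apply: le_trans (_ : (l2norm (z - z))%:E <= _)%E.
        by rewrite lee_fin l2norm_ge0.
      by apply: ereal_sup_ubound; exists (z, z).
    by rewrite -lee_fin -diamM; apply: ereal_sup_ubound; exists (z, w).
  by apply: stationarity_gap_bound => // z w; exact: sqr_le.
have c0 : convexity_constant h c (edom g) 0 by rewrite -r0.
have rho0 : weakly_convex_on (edom g) 0 (h \o c).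
  by apply: convexity_constant_weakly_convex => //; exact: edom_segment_closed.
have zM z w : edom g z -> edom g w ->
    0 * l2norm (z - w) ^+ 2 <= 0 * 0 ^+ 2 :> R by rewrite !mul0r.
have K0 : (0 : R) ^+ 2 * (0 + 0 / 2 * (N%:R + 3)) = 0 by rewrite expr0n/= mul0r.
split.
  by rewrite -[X in stationarity_bound _ _ _ X]K0; apply: stationarity_gap_bound.
rewrite (compositeE h c g_proper (x_edom g_proper xvP N)).
rewrite (compositeE h c g_proper (xs_edom g_proper xvP xsP)) -EFinB lee_fin.
exact: (value_gap_bound g_proper g_convex L_ge0 h_convex h_lip beta_ge0 c_C1 c_lip
  mut_gt rho0 c0 (lexx 0) (lexx 0) eps_ge0 delta_ge0 xvP xsP zM zM N1 K0).
Qed.
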